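(* Let $\mathbb{F}$ be the Fano plane, i.e. the $3$-graph on vertex set $\{1,\dots,7\}$ with $3$-edges $123, 345, 156, 246, 147, 257, 367$. For every positive integer $n$, $$\mathrm{co^+ex}(n,\mathbb{F})\le \frac23 n .$$ Moreover, this bound is sharp when $n$ is divisible by $6$, i.e. $\mathrm{co^+ex}(n,\mathbb{F})=\frac23 n$ for every positive integer $n$ divisible by $6$.
   Context: A $3$-graph is a finite $3$-uniform hypergraph; an edge is written as the concatenation of its vertices. The minimum positive co-degree $\delta_2^+(H)$ of a non-empty $3$-graph $H$ is the maximum $k$ such that every pair of vertices contained in some edge of $H$ is contained in at least $k$ distinct edges of $H$; by convention it is $0$ if $H$ has no edges. A hypergraph is $F$-free if it has no (not necessarily induced) subhypergraph isomorphic to $F$. $\mathrm{co^+ex}(n,F)$ is the maximum of $\delta_2^+(H)$ over all $n$-vertex $F$-free $3$-graphs $H$. *)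

(* Defs.v *)
From HB Require Import structures.
From mathcomp Require Import all_boot.
Set Implicit Arguments.
Unset Strict Implicit.
Unset Printing Implicit Defensive.

Record graph3 (T : finType) := Graph3 {
  edges :> {set {set T}};
  edges_uniform : [forall e in edges, #|e| == 3] }.

HB.instance Definition _ (T : finType) := [isSub for @edges T].
HB.instance Definition _ (T : finType) := [Finite of graph3 T by <:].

Definition codegree (T : finType) (H : graph3 T) (P : {set T}) : nat :=
  #|[set e in edges H | P \subset e]|.

(* The range of [k] loses nothing: when [H] has an edge, some pair is covered,
   and its codegree is at most the number of edges of [H]. *)
Definition min_pos_codegree (T : finType) (H : graph3 T) : nat :=
  if edges H == set0 then 0 else
  \max_(k < #|edges H|.+1 |
      [forall P : {set T},
         (#|P| == 2) && [exists e in edges H, P \subset e] ==>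
         (k <= codegree H P)]) k.

(* The hypergraph with vertex set [f @: S] and edge set [[set f @: e | e in F]]
   is the copy of [F] in [H]; the copy need not be induced. *)
Definition has_copy (S T : finType) (F : graph3 S) (H : graph3 T) : bool :=
  [exists f : {ffun S -> T},
     injectiveb f && ([set f @: e | e : {set S} in edges F] \subset edges H)].

Definition copy_free (S T : finType) (F : graph3 S) (H : graph3 T) : bool :=
  ~~ has_copy F H.

Definition copos_ex (S : finType) (n : nat) (F : graph3 S) : nat :=
  \max_(H : graph3 'I_n | copy_free F H) min_pos_codegree H.

(* The vertices 1, ..., 7 are encoded as the ordinals 0, ..., 6. *)
Definition fano_line (a b c : nat) : {set 'I_7} :=
  [set x : 'I_7 | x.+1 \in [:: a; b; c]].

Definition fano_edges : {set {set 'I_7}} :=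
  [set fano_line 1 2 3; fano_line 3 4 5; fano_line 1 5 6; fano_line 2 4 6;
       fano_line 1 4 7; fano_line 2 5 7; fano_line 3 6 7].

Fact fano_uniform : [forall e in fano_edges, #|e| == 3].
Proof.
apply/forall_inP=> e; rewrite !inE -!orbA.
by do ![case/predU1P=> [->|]]; last move/eqP->;
  rewrite cardsE -sum1_card big_mkcond /= !big_ord_recl big_ord0.
Qed.

Definition fano : graph3 'I_7 := Graph3 fano_uniform.

(* Main.v *)
(* Suppose every covered pair has codegree more than 2n/3. The three pairs of an
   edge abc have a common neighbour d, so all six pairs of abcd are covered.
   Each of X = N(ab) :&: N(cd), Y = N(ad) :&: N(bc), Z = N(ac) :&: N(bd) then
   has more than n/3 elements, hence meets the neighbourhood of every covered pair.
   Pick x in X, then y in Y :&: N(xa), so that xy is covered, then z in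
   Z :&: N(xy): the seven points a, b, c, d, x, y, z carry a Fano plane.

   Sharpness for n = 6m comes from the balanced blow-up of the complete 3-graph
   on 6 vertices: all pairs of the Fano plane are covered, so a copy would have
   its seven vertices in different parts. *)
Require Import Defs.
From mathcomp Require Import all_boot all_order all_algebra.
From mathcomp Require Import zify lra.
Import Order.TTheory GRing.Theory Num.Theory.
Local Open Scope ring_scope.

Set Implicit Arguments.
Unset Strict Implicit.
Unset Printing Implicit Defensive.

(** * Neighbourhoods of pairs and the upper bound *)

Section Graph3.
Local Open Scope nat_scope.
Variables (T : finType) (H : graph3 T).
Implicit Types (a b c x y z : T) (A B C P e : {set T}).

Lemma edge_card e : e \in edges H -> #|e| = 3.
Proof. by move/(forall_inP (edges_uniform H))/eqP. Qed.

Lemma edge_neq a b c :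
  [set a; b; c] \in edges H -> [/\ a != b, a != c & b != c].
Proof.
move/edge_card; rewrite setUC cardsU1 cards2 !inE.
by rewrite [c == a]eq_sym [c == b]eq_sym; do 3 case: eqP.
Qed.

(** Degenerate cases vanish: edges have three elements, so [nbr a b] contains neither [a] nor [b]
    and is empty when [a = b]. *)
Definition nbr a b : {set T} := [set v | [set a; b; v] \in edges H].

Lemma edge_third a b e :
    a != b -> e \in edges H -> [set a; b] \subset e ->
  exists2 v, v \in nbr a b & e = [set a; b; v].
Proof.
move=> ab eH sub; have e3 := edge_card eH.
have : #|e :\: [set a; b]| == 1 by rewrite cardsDS // e3 cards2 ab.
case/cards1P=> v dv.
have De : e = [set a; b; v].
  by rewrite -dv -[LHS](setID e [set a; b]) (setIidPr sub).
by exists v; rewrite // inE -De.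
Qed.

Lemma edge_triple e :
  e \in edges H -> exists a b c, a != b /\ e = [set a; b; c].
Proof.
move=> eH; have /card_gt1P[a [b [ae be ab]]] : 1 < #|e| by rewrite edge_card.
have [c _ De] : exists2 c, c \in nbr a b & e = [set a; b; c].
  by apply: edge_third => //; rewrite subUset !sub1set ae.
by exists a, b, c.
Qed.

Lemma codegree_nbr a b : a != b -> codegree H [set a; b] <= #|nbr a b|.
Proof.
move=> ab; apply: leq_trans (leq_imset_card (fun v => [set a; b; v]) _).
apply/subset_leq_card/subsetP=> e; rewrite inE => /andP[eH sub].
by have [v vN ->] := edge_third ab eH sub; apply: imset_f.
Qed.

Lemma setI2_large A B :
  #|T| < #|A| + #|B| -> exists2 x, x \in A & x \in B.
Proof.
rewrite -cardsUI => lt_T.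
have /card_gt0P[x] : 0 < #|A :&: B| by have := max_card (A :|: B); lia.
by case/setIP; exists x.
Qed.

(** Together with [setI2_large], this gives a common point of three sets whose sizes sum to more
    than [2 * #|T|]. *)
Lemma leq_cardsD_setI A B : #|A| + #|B| <= #|A :&: B| + #|T|.
Proof. by rewrite -cardsUI addnC leq_add2l max_card. Qed.

(** The points [x y z c a b d] play 1, ..., 7, and the hypotheses follow the order of [fano_edges].
    Distinctness comes for free: each of the 21 pairs lies in one of the seven edges. *)
Lemma fano_copy x y z c a b d :
    [set x; y; z] \in edges H -> [set z; c; a] \in edges H ->
    [set x; a; b] \in edges H -> [set y; c; b] \in edges H ->
    [set x; c; d] \in edges H -> [set y; a; d] \in edges H ->
    [set z; b; d] \in edges H ->
  has_copy fano H.
Proof.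
move=> Exyz Ezca Exab Eycb Excd Eyad Ezbd.
pose s := [:: x; y; z; c; a; b; d].
pose f := [ffun i : 'I_7 => nth x s i].
have us : uniq s.
  have [xy xz yz] := edge_neq Exyz; have [zc za ca] := edge_neq Ezca.
  have [xa xb ab] := edge_neq Exab; have [yc yb cb] := edge_neq Eycb.
  have [xc xd cd] := edge_neq Excd; have [ya yd ad] := edge_neq Eyad.
  have [zb zd bd] := edge_neq Ezbd.
  by rewrite /= !inE !negb_or xy xz yz zc za ca xa xb ab yc yb cb xc xd cd
    ya yd ad zb zd bd.
have f_line i j k : i < 7 -> j < 7 -> k < 7 ->
    f @: fano_line i.+1 j.+1 k.+1 = [set nth x s i; nth x s j; nth x s k].
  move=> i7 j7 k7; apply/setP=> v; rewrite !inE; apply/imsetP/idP.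
    by case=> u; rewrite !inE !eqSS ffunE -orbA => /or3P[] /eqP-> ->;
       rewrite eqxx ?orbT.
  by rewrite -orbA => /or3P[] /eqP->;
    [exists (Ordinal i7) | exists (Ordinal j7) | exists (Ordinal k7)];
    rewrite ?ffunE // !inE eqxx ?orbT.
apply/existsP; exists f; apply/andP; split.
  apply/injectiveP=> i j; rewrite !ffunE => /eqP.
  by rewrite nth_uniq // => /eqP/val_inj.
apply/subsetP=> _ /imsetP[e eF ->]; move: eF; rewrite !inE -!orbA.
by do ![case/predU1P=> [->|]]; last move/eqP->; rewrite f_line.
Qed.

Lemma fano_of_large_codegree k :
    edges H != set0 -> 2 * #|T| < 3 * k ->
    (forall P, #|P| = 2 -> (exists2 e, e \in edges H & P \subset e) ->
       k <= codegree H P) ->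
  has_copy fano H.
Proof.
move=> /set0Pn[e0 e0H] lt_k kP.
have nbr_ge a b c : [set a; b; c] \in edges H -> k <= #|nbr a b|.
  move=> E; have [ab _ _] := edge_neq E.
  apply: leq_trans (codegree_nbr ab); apply: kP; first by rewrite cards2 ab.
  by exists [set a; b; c]; rewrite ?subsetUl.
have perm132 a b c : [set a; b; c] = [set a; c; b] by rewrite setUAC.
have perm231 a b c : [set a; b; c] = [set b; c; a] by rewrite -setUA setUC.
have [a [b [c Eabc]]] : exists a b c, [set a; b; c] \in edges H.
  have [a [b [c [_ De]]]] := edge_triple e0H; by exists a, b, c; rewrite -De.
have Nab := nbr_ge _ _ _ Eabc.
have Nbc : k <= #|nbr b c| by apply: (nbr_ge _ _ a); rewrite -perm231.
have Nac : k <= #|nbr a c| by apply: (nbr_ge _ _ b); rewrite perm132.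
have [d] : exists2 d, d \in nbr a b :&: nbr b c & d \in nbr a c.
  (* The intersection has at least [2k - #|T|] points, and [(2k - #|T|) + k] exceeds [#|T|]. *)
  apply: setI2_large; have := leq_cardsD_setI (nbr a b) (nbr b c); lia.
rewrite !inE => /andP[Eabd Ebcd] Eacd.
have Ncd : k <= #|nbr c d| by apply: (nbr_ge _ _ b); rewrite -perm231.
have Nad : k <= #|nbr a d| by apply: (nbr_ge _ _ b); rewrite perm132.
have Nbd : k <= #|nbr b d| by apply: (nbr_ge _ _ a); rewrite -perm231.
have [x] : exists2 x, x \in nbr a b & x \in nbr c d by apply: setI2_large; lia.
rewrite !inE => Eabx Ecdx.
have Nxa : k <= #|nbr x a| by apply: (nbr_ge _ _ b); rewrite perm231.
have [y] : exists2 y, y \in nbr a d :&: nbr b c & y \in nbr x a.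
  apply: setI2_large; have := leq_cardsD_setI (nbr a d) (nbr b c); lia.
rewrite !inE => /andP[Eady Ebcy] Exay.
have Nxy : k <= #|nbr x y| by apply: (nbr_ge _ _ a); rewrite perm132.
have [z] : exists2 z, z \in nbr a c :&: nbr b d & z \in nbr x y.
  apply: setI2_large; have := leq_cardsD_setI (nbr a c) (nbr b d); lia.
rewrite !inE => /andP[Eacz Ebdz] Exyz.
(* In the quadrangle [abcd], each diagonal point [x], [y], [z] lies on two opposite sides; the
   seventh line is [xyz]. *)
apply: (@fano_copy x y z c a b d) => //.
- by rewrite perm132 perm231.
- by rewrite perm231.
- by rewrite perm132 perm231.
- by rewrite perm231.
- by rewrite perm231.
- by rewrite perm231.
Qed.

Lemma min_pos_codegree_fano_free :
  copy_free fano H -> 3 * min_pos_codegree H <= 2 * #|T|.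
Proof.
move=> free; rewrite /min_pos_codegree.
case: (edges H =P set0) => [|/eqP H0]; first by [].
(* With the factor 3 turned into a floor division, it suffices to bound each term of the maximum by
   one constant. *)
have div3 m : (3 * m <= 2 * #|T|) = (m <= (2 * #|T|) %/ 3) by lia.
rewrite div3; apply/bigmax_leqP => k /forallP kP; rewrite -div3 leqNgt.
apply: contra free => lt_k.
apply: (@fano_of_large_codegree k) => // P P2 [e eH sub].
apply: (implyP (kP P)); rewrite P2 eqxx.
by apply/exists_inP; exists e.
Qed.

Lemma leq_min_pos_codegree k :
    edges H != set0 ->
    (forall a b e, a != b -> e \in edges H -> [set a; b] \subset e ->
       k <= codegree H [set a; b]) ->
  k <= min_pos_codegree H.
Proof.
move=> H0 kP; rewrite /min_pos_codegree (negPf H0).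
(* [k] must lie in the index range of the maximum: it is at most the codegree of some covered pair,
   hence at most the number of edges. *)
have lt_k : k < #|edges H|.+1.
  have /set0Pn[e eH] := H0.
  have [a [b [c [ab De]]]] := edge_triple eH.
  apply: leq_trans (kP a b e ab eH _) _; first by rewrite De subsetUl.
  by apply/subset_leq_card/subsetP=> e'; rewrite inE => /andP[].
apply: (leq_bigmax_cond (Ordinal lt_k)); apply/forallP=> P; apply/implyP.
case/andP=> /cards2P[a [b [ab DP]]] /exists_inP[e eH sub].
by move: sub; rewrite DP; apply: kP.
Qed.

End Graph3.

(** * Blow-ups of complete 3-graphs *)

Lemma fano_pair_covered (i j : 'I_7) :
  exists2 e, e \in edges fano & (i \in e) && (j \in e).
Proof.
pose lines := [:: (1, 2, 3); (3, 4, 5); (1, 5, 6); (2, 4, 6); (1, 4, 7);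
                  (2, 5, 7); (3, 6, 7)]%N.
pose on x (t : nat * nat * nat) := x.+1 \in [:: t.1.1; t.1.2; t.2].
(* Incidence is coded on plain numbers, so that evaluation settles all 49 pairs. *)
have cover : all (fun x => all (fun y => has (fun t => on x t && on y t) lines)
                               (iota 0 7)) (iota 0 7) by vm_compute.
have I7 (k : 'I_7) : (k : nat) \in iota 0 7 by rewrite mem_iota ltn_ord.
have /hasP[[[a b] c] t_line /andP[it jt]] :=
  allP (allP cover i (I7 i)) j (I7 j).
exists (fano_line a b c); last by rewrite !in_set; apply/andP; split.
move: t_line; rewrite !inE -!orbA.
by do ![case/predU1P=> [[-> -> ->]|]]; last move/eqP=> [-> -> ->];
   rewrite eqxx ?orbT.
Qed.

Lemma card_set3 (U : finType) (a b c : U) :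
  a != b -> c != a -> c != b -> #|[set a; b; c]| = 3%N.
Proof.
by move=> ab ca cb; rewrite setUC cardsU1 cards2 !inE negb_or ca cb ab.
Qed.

Section BlowUp.
Local Open Scope nat_scope.
Variables (T K : finType) (col : T -> K).

(** This is the blow-up of the complete 3-graph on [K], whose parts are the fibres of [col]. *)
Definition rainbow_edges : {set {set T}} :=
  [set e : {set T} | (#|e| == 3) && (#|col @: e| == 3)].

Fact rainbow_uniform : [forall e in rainbow_edges, #|e| == 3].
Proof. by apply/forall_inP=> e; rewrite inE => /andP[]. Qed.

Definition rainbow : graph3 T := Graph3 rainbow_uniform.

Lemma rainbow_col_inj e : e \in edges rainbow -> {in e &, injective col}.
Proof.
by rewrite inE => /andP[/eqP e3 /eqP c3]; apply/imset_injP; rewrite c3 e3.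
Qed.

Lemma rainbow_edge a b c :
    col a != col b -> col c != col a -> col c != col b ->
  [set a; b; c] \in edges rainbow.
Proof.
move=> ab ca cb; rewrite inE !imsetU !imset_set1 !card_set3 ?eqxx //.
- by apply: contraNneq ab => ->.
- by apply: contraNneq ca => ->.
- by apply: contraNneq cb => ->.
Qed.

Lemma rainbow_codegree a b :
    col a != col b ->
  #|[set v | col v \notin [set col a; col b]]| <= codegree rainbow [set a; b].
Proof.
move=> ab; rewrite -(card_in_imset (f := fun v => [set a; b; v])).
  apply/subset_leq_card/subsetP=> _ /imsetP[v + ->].
  by rewrite !inE negb_or subsetUl andbT => /andP[va vb];
     have := rainbow_edge ab va vb; rewrite inE.
(* If [abv] and [abw] are the same edge, then [v] is one of [a], [b], [w], and its colour rules out
   [a] and [b]. *)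
move=> v w; rewrite !inE !negb_or => /andP[va vb] _ /setP/(_ v).
rewrite !inE eqxx orbT -orbA => /esym/or3P[] /eqP E //.
  by rewrite E eqxx in va.
by rewrite E eqxx in vb.
Qed.

Lemma rainbow_fano_free : #|K| < 7 -> copy_free fano rainbow.
Proof.
move=> K7; apply/negP=> /existsP[f /andP[/injectiveP f_inj /subsetP sub]].
suff /leq_card : injective (col \o f) by rewrite card_ord leqNgt K7.
move=> i j /= col_ij; have [e eF /andP[ie je]] := fano_pair_covered i j.
apply/f_inj/(rainbow_col_inj (sub _ (imset_f _ eF))) => //; exact: imset_f.
Qed.

End BlowUp.

(** Vertices are identified with pairs in ['I_q * 'I_m] and coloured by the first coordinate. *)
Lemma balanced_coloring (q m : nat) :
  exists col : 'I_(q * m) -> 'I_q,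
    forall A : {set 'I_q}, #|[set v | col v \in A]| = (#|A| * m)%N.
Proof.
have qm : #|{: 'I_q * 'I_m}| = (q * m)%N by rewrite card_prod !card_ord.
pose g := enum_val \o cast_ord (esym qm).
have g_bij : bijective g.
  apply: bij_comp (enum_val_bij _) _.
  by exists (cast_ord qm); [apply: cast_ordKV | apply: cast_ordK].
exists (fst \o g) => A.
rewrite -[m in RHS]card_ord -cardsT -cardsX.
rewrite -(on_card_preimset (onW_bij _ g_bij)).
by apply: eq_card => v; rewrite !inE andbT.
Qed.

(** * The two bounds on the extremal number *)

Lemma copos_ex_fano_le n : (3 * copos_ex n fano <= 2 * n)%N.
Proof.
have div3 m : (3 * m <= 2 * n)%N = (m <= (2 * n) %/ 3)%N by lia.
rewrite div3; apply/bigmax_leqP=> H free.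
by rewrite -div3 -[n in leqRHS]card_ord min_pos_codegree_fano_free.
Qed.

Lemma copos_ex_fano_ge m : (0 < m)%N -> (4 * m <= copos_ex (6 * m) fano)%N.
Proof.
move=> m_gt0; have [col col_card] := balanced_coloring 6 m.
have free : copy_free fano (rainbow col) by rewrite rainbow_fano_free ?card_ord.
apply: leq_trans (leq_bigmax_cond _ free).
have fiber_card (A : {set 'I_6}) :
    #|[set v | col v \notin A]| = ((6 - #|A|) * m)%N.
  have -> : (6 - #|A|)%N = #|~: A| by rewrite [RHS]cardsCs setCK card_ord.
  by rewrite -col_card; apply: eq_card => v; rewrite !inE.
have new_col (A : {set 'I_6}) : (#|A| < 6)%N -> exists v, col v \notin A.
  move=> A6; have /card_gt0P[v] : (0 < #|[set v | col v \notin A]|)%N.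
    by rewrite fiber_card muln_gt0 subn_gt0 A6.
  by rewrite inE; exists v.
apply: leq_min_pos_codegree => [|a b e ab eH sub].
  (* An edge must be exhibited, since an edgeless graph has value 0 by convention. As [m > 0], no
     part is empty and three colours can be picked greedily. *)
  have [a _] : exists v, col v \notin set0 by apply: new_col; rewrite cards0.
  have [b] : exists v, col v \notin [set col a].
    by apply: new_col; rewrite cards1.
  rewrite inE => ba.
  have [c] : exists v, col v \notin [set col a; col b].
    by apply: new_col; rewrite cards2; case: eqP.
  rewrite !inE negb_or => /andP[ca cb].
  by apply/set0Pn; exists [set a; b; c]; rewrite rainbow_edge // eq_sym.
have col_ab : col a != col b.
  move: sub; rewrite subUset !sub1set => /andP[ae be].
  by apply: contraNneq ab => /(rainbow_col_inj eH ae be)->.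
(* The pair uses two colours, leaving four parts of [m] vertices each. *)
by apply: leq_trans (rainbow_codegree col_ab); rewrite fiber_card cards2 col_ab.
Qed.

Theorem theorem10 :
  (forall n : nat, (0 < n)%N ->
     (copos_ex n fano)%:R <= 2 / 3 * n%:R :> rat) /\
  (forall n : nat, (0 < n)%N -> (6 %| n)%N ->
     (copos_ex n fano)%:R = 2 / 3 * n%:R :> rat).
Proof.
have upper n : (copos_ex n fano)%:R <= 2 / 3 * n%:R :> rat.
  have := copos_ex_fano_le n; rewrite -(ler_nat rat) !natrM; lra.
split=> [n _ | n n_gt0 /dvdnP[m Dn]]; first exact: upper.
(* For [n = 6m] the upper bound is [4m], which the blow-up attains. *)
apply/eqP; rewrite eq_le upper /= Dn mulnC.
have m_gt0 : (0 < m)%N by lia.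
have := copos_ex_fano_ge m_gt0; rewrite -(ler_nat rat) !natrM; lra.
Qed.
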